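(* Let $n$ be a positive integer and let $\mathcal F$ be an $\mathcal N$-saturated family of subsets of $[n]$. Then $|\mathcal F|\ge\frac{n+6}{4}$.
   Context: The poset $\mathcal N$ has four elements $a,b,c,d$ with $a<c$, $b<c$, $b<d$ and no other comparabilities. A family $\mathcal Q$ of sets (ordered by inclusion) contains an induced copy of $\mathcal N$ if there are distinct sets in $\mathcal Q$ whose inclusion relations are exactly those of $a,b,c,d$ above. A family $\mathcal F$ of subsets of $[n]=\{1,\dots,n\}$ is $\mathcal N$-saturated if $\mathcal F$ contains no induced copy of $\mathcal N$, but for every $S\subseteq[n]$ with $S\notin\mathcal F$, the family $\mathcal F\cup\{S\}$ contains an induced copy of $\mathcal N$. *)

(* Defs.v *)
From mathcomp Require Import all_boot.
Set Implicit Arguments. Unset Strict Implicit. Unset Printing Implicit Defensive.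

Definition comparable_sets (T : finType) (x y : {set T}) : bool :=
  (x \subset y) || (y \subset x).

Definition is_induced_N (T : finType) (a b c d : {set T}) : bool :=
  [&& uniq [:: a; b; c; d],
      a \proper c, b \proper c, b \proper d,
      ~~ comparable_sets a b, ~~ comparable_sets a d & ~~ comparable_sets c d].

Definition contains_induced_N (T : finType) (Q : {set {set T}}) : Prop :=
  exists a b c d, [/\ a \in Q, b \in Q, c \in Q, d \in Q & is_induced_N a b c d].

Definition N_saturated (n : nat) (F : {set {set 'I_n}}) : Prop :=
  ~ contains_induced_N F /\
  forall S : {set 'I_n}, S \notin F -> contains_induced_N (S |: F).

(* Main.v *)
Require Import Defs.
From mathcomp Require Import all_boot all_order all_algebra.

(* A saturated family F satisfies the stronger bound n < #|F|: the indicator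
   vectors of its nonempty members span rat^n. Otherwise some nonzero weight w
   on the points sums to 0 on every member. If S meets the support W of w
   exactly in the points of positive weight, then the members below S avoid W
   and the members above S contain W; such an S is not in F, and it remains to
   choose its other points so that F and S together have no induced N. For this
   take a minimal module M of F (all members outside M compare in the same way
   with all elements of M) that contains, for some nonempty W' in the support,
   sets A <= C with A avoiding W' and C containing W', all traces on W' of
   elements of M having weight 0. As an N-free poset is decomposable, M is a
   parallel or a series composition; minimality excludes the former and forces
   M = M1 < M2 with M1 avoiding W' and M2 containing it, and then S can be
   placed between M1 and M2. *)

Set Implicit Arguments. Unset Strict Implicit. Unset Printing Implicit Defensive.
Import Order.TTheory GRing.Theory Num.Theory.

(** * Induced copies of the poset N among finite sets *)

Section InducedN.
Variable T : finType.
Implicit Types (x y z a b c d S : {set T}) (F M Q : {set {set T}}).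

(** Distinctness and strictness come for free: an equality between related sets would make one of
    the three incomparable pairs comparable. *)
Lemma is_induced_NE a b c d :
  is_induced_N a b c d =
  [&& a \subset c, b \subset c, b \subset d,
      ~~ comparable_sets a b, ~~ comparable_sets a d & ~~ comparable_sets c d].
Proof.
rewrite /is_induced_N; apply/idP/idP.
  by case/and5P => _ /proper_sub-> /proper_sub-> /proper_sub-> ->.
case/and5P => ac bc bd ab /andP[ad cd]; rewrite ab ad cd.
have nca : ~~ (c \subset a).
  by apply: contra ab => ca; rewrite /comparable_sets (subset_trans bc ca) orbT.
have ncb : ~~ (c \subset b).
  by apply: contra ab => cb; rewrite /comparable_sets (subset_trans ac cb).
have ndb : ~~ (d \subset b).
  by apply: contra cd => db; rewrite /comparable_sets (subset_trans db bc) orbT.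
rewrite !properE ac bc bd nca ncb ndb /= !inE !negb_or !andbT.
have neq x y : ~~ comparable_sets x y -> x != y.
  by apply: contra => /eqP->; rewrite /comparable_sets subxx.
rewrite (neq a b) // (neq a d) // (neq c d) // !andbT /=.
apply/and3P; split.
- by apply: contra nca => /eqP->.
- by apply: contra ncb => /eqP->.
- by apply: contra ndb => /eqP->.
Qed.

Lemma contains_induced_NI F a b c d :
  a \in F -> b \in F -> c \in F -> d \in F ->
  a \subset c -> b \subset c -> b \subset d ->
  ~~ comparable_sets a b -> ~~ comparable_sets a d -> ~~ comparable_sets c d ->
  contains_induced_N F.
Proof.
move=> aF bF cF dF ac bc bd ab ad cd; exists a, b, c, d; split=> //.
by rewrite is_induced_NE ac bc bd ab ad cd.
Qed.

Lemma contains_induced_N_sub F Q :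
  Q \subset F -> contains_induced_N Q -> contains_induced_N F.
Proof.
move=> /subsetP sQF [a [b [c [d [aQ bQ cQ dQ abcd]]]]].
by exists a, b, c, d; split=> //; apply: sQF.
Qed.

(** * Parallel and series decomposition of N-free families *)

Definition parallel Q1 Q2 :=
  forall x y, x \in Q1 -> y \in Q2 -> ~~ comparable_sets x y.

Definition series Q1 Q2 := forall x y, x \in Q1 -> y \in Q2 -> x \proper y.

Definition decomposable Q := exists Q1 Q2,
  [/\ Q = Q1 :|: Q2, Q1 != set0, Q2 != set0 & parallel Q1 Q2 \/ series Q1 Q2].

Lemma decomposableI Q (D : pred {set T}) u v :
    u \in Q -> D u -> v \in Q -> ~~ D v ->
    (forall x y, x \in Q -> y \in Q -> D x -> ~~ D y -> ~~ comparable_sets x y)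
    \/ (forall x y, x \in Q -> y \in Q -> D x -> ~~ D y -> x \proper y) ->
  decomposable Q.
Proof.
move=> uQ Du vQ Dv H.
exists [set x in Q | D x], [set x in Q | ~~ D x]; split.
- by apply/setP=> x; rewrite !inE -andb_orr orbN andbT.
- by apply/set0Pn; exists u; rewrite inE uQ.
- by apply/set0Pn; exists v; rewrite inE vQ.
case: H => H; [left|right] => x y; rewrite !inE => /andP[xQ Dx] /andP[yQ Dy];
  exact: H.
Qed.

Lemma properEsub x y : x \subset y -> x != y -> x \proper y.
Proof. by move=> xy nxy; rewrite properEneq nxy. Qed.

Lemma incomparableP x y :
  ~~ comparable_sets x y -> ~~ (x \subset y) /\ ~~ (y \subset x).
Proof. by rewrite negb_or => /andP. Qed.

Lemma comparable_setsC x y : comparable_sets x y = comparable_sets y x.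
Proof. exact: orbC. Qed.

(* Order version of the theorem that a P4-free graph or its complement is
   disconnected; a single element [x] is added to a decomposed family. *)
Lemma N_free_decomposable Q :
  1 < #|Q| -> ~ contains_induced_N Q -> decomposable Q.
Proof.
have [k] := ubnP #|Q|; elim: k Q => // k IH Q ltQ Q1 nN.
have [x xQ] : exists x, x \in Q by apply/card_gt0P; exact: ltnW.
have cardQ := cardsD1 x Q; rewrite xQ in cardQ.
have [le1|gt1] := leqP #|Q :\ x| 1.
  have /cards1P[y Qy] : #|Q :\ x| == 1 by rewrite eqn_leq le1; move: Q1; rewrite cardQ.
  have [yx yQ] : y != x /\ y \in Q by apply/setD1P; rewrite Qy set11.
  have inQ z : z \in Q -> z = x \/ z = y.
    move=> zQ; have [->|zx] := eqVneq z x; first by left.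
    by right; apply/set1P; rewrite -Qy !inE zx.
  have [xy|nxy] := boolP (comparable_sets x y); last first.
    apply: (@decomposableI _ (pred1 x) x y) => //=; left=> u v uQ vQ /eqP-> vx.
    by case: (inQ v vQ) vx => -> //; rewrite eqxx.
  case/orP: xy => xy.
    apply: (@decomposableI _ (pred1 x) x y) => //=; right=> u v uQ vQ /eqP-> vx.
    case: (inQ v vQ) vx => ->; first by rewrite eqxx.
    by move=> _; apply: properEsub => //; rewrite eq_sym.
  apply: (@decomposableI _ (pred1 y) y x) => //=; first by rewrite eq_sym.
  right=> u v uQ vQ /eqP-> vy; case: (inQ v vQ) vy => ->; last by rewrite eqxx.
  by move=> _; apply: properEsub.
have sQ : Q :\ x \subset Q by apply: subsetDl.
have [||Q2 [Q3 [QE /set0Pn[q2 q2Q] /set0Pn[q3 q3Q] H]]] := IH (Q :\ x) _ gt1.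
- by move: ltQ; rewrite cardQ.
- by move=> /(contains_induced_N_sub sQ).
have inQ z : z \in Q -> [\/ z = x, z \in Q2 | z \in Q3].
  move=> zQ; have [->|zx] := eqVneq z x; first by constructor 1.
  have : z \in Q :\ x by rewrite !inE zx.
  by rewrite QE => /setUP[]; [constructor 2|constructor 3].
have Q2Q z : z \in Q2 -> z != x /\ z \in Q.
  by move=> zQ; apply/setD1P; rewrite QE inE zQ.
have Q3Q z : z \in Q3 -> z != x /\ z \in Q.
  by move=> zQ; apply/setD1P; rewrite QE inE zQ orbT.
have [q2x q2Q'] := Q2Q _ q2Q; have [q3x q3Q'] := Q3Q _ q3Q.
case: H => H.
(* Here [v] in [A] is incomparable to [x] while [z] in [B] is comparable to it. The members of [A]
   incomparable to [x] split off in parallel: if such a [v] were comparable to some [u] in [A] with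
   [u] comparable to [x], then [v], [u], [x], [z] would form a path in the comparability graph. By
   transitivity its directions alternate, so it is an N. *)
- have key A B : parallel A B ->
      (forall z, z \in Q -> [\/ z = x, z \in A | z \in B]) ->
      (forall z, z \in A -> z != x /\ z \in Q) ->
      (forall z, z \in B -> z != x /\ z \in Q) ->
      forall v z, v \in A -> ~~ comparable_sets x v -> z \in B ->
      comparable_sets x z -> decomposable Q.
    move=> AB inAB AQ BQ v z vA xv zB xz.
    have [vx vQ] := AQ _ vA; have [zx zQ] := BQ _ zB.
    have az u : u \in A -> ~~ (z \subset u) /\ ~~ (u \subset z).
      by move=> uA; have [] := incomparableP (AB _ _ uA zB).
    apply: (@decomposableI _ (fun t => (t \in A) && ~~ comparable_sets x t) v x);
      rewrite ?vA ?xv //=.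
      by rewrite negb_and negbK /comparable_sets subxx !orbT.
    left=> {v vA xv vx vQ} v u vQ uQ /andP[vA xv].
    case: (inAB u uQ) => [->|uA|uB] /=; first by rewrite comparable_setsC.
      rewrite uA negbK /= => xu; apply/negP => vu.
      have [zu uz] := az _ uA; have [zv vz] := az _ vA.
      have [xv1 xv2] := incomparableP xv.
      apply: nN; have [ux uQ'] := AQ _ uA.
      case/orP: xz => xz; case/orP: xu => xu; case/orP: vu => vu.
      + apply: (@contains_induced_NI Q v x u z) => //;
          by rewrite /comparable_sets negb_or ?vz ?zv ?zu ?uz ?xv1 ?xv2.
      + by case/negP: xv1; apply: subset_trans xu vu.
      + by case/negP: uz; apply: subset_trans xu xz.
      + by case/negP: uz; apply: subset_trans xu xz.
      + by case/negP: zu; apply: subset_trans xz xu.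
      + by case/negP: zu; apply: subset_trans xz xu.
      + by case/negP: xv2; apply: subset_trans vu xu.
      + apply: (@contains_induced_NI Q z u x v) => //;
          by rewrite /comparable_sets negb_or ?vz ?zv ?zu ?uz ?xv1 ?xv2.
    by move=> _; apply: AB.
  have [/existsP[v /andP[vQ xv]]|all_x] :=
      boolP [exists v, (v \in Q) && ~~ comparable_sets x v]; last first.
    (* With [x] comparable to everything, the family is cut in series just below or just above [x],
       according to the side of [q2]. *)
    have cmp v : v \in Q -> comparable_sets x v.
      move=> vQ; apply: contraNT all_x => xv.
      by apply/existsP; exists v; rewrite vQ.
    have [q2s|q2s] := boolP (q2 \subset x).
      apply: (@decomposableI _ (fun t => t \proper x) q2 x);
        rewrite ?properxx //=; first exact: properEsub.
      right=> u v uQ vQ ux; rewrite properE negb_and negbK => nvx.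
      apply: proper_sub_trans ux _; case/orP: (cmp v vQ) => // vx.
      by move: nvx; rewrite vx.
    have xq2 : x \proper q2.
      apply: properEsub; last by rewrite eq_sym.
      by case/orP: (cmp q2 q2Q'); last by rewrite (negPf q2s).
    apply: (@decomposableI _ (fun t => t \subset x) x q2) => //.
    right=> u v uQ vQ ux vx; apply: sub_proper_trans ux _.
    apply: properEsub; first by case/orP: (cmp v vQ); last by rewrite (negPf vx).
    by apply: contraNneq vx => <-.
  have [/existsP[z2 /andP[z2Q xz2]]|no2] :=
      boolP [exists z, (z \in Q2) && comparable_sets x z]; last first.
    apply: (@decomposableI _ (mem Q2) q2 x) => //=.
      by apply/negP => /Q2Q[]; rewrite eqxx.
    left=> u y uQ yQ uQ2 yQ2; case: (inQ y yQ) => [->|yQ2'|]; last exact: H.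
      apply: contra no2 => ux; apply/existsP; exists u.
      by rewrite uQ2 comparable_setsC.
    by rewrite yQ2' in yQ2.
  have [/existsP[z3 /andP[z3Q xz3]]|no3] :=
      boolP [exists z, (z \in Q3) && comparable_sets x z]; last first.
    apply: (@decomposableI _ (mem Q3) q3 x) => //=.
      by apply/negP => /Q3Q[]; rewrite eqxx.
    left=> u y uQ yQ uQ2 yQ2; case: (inQ y yQ) => [->|yQ2'|yQ3].
    + apply: contra no3 => ux; apply/existsP; exists u.
      by rewrite uQ2 comparable_setsC.
    + by rewrite comparable_setsC; apply: H.
    + by rewrite yQ3 in yQ2.
  case: (inQ v vQ) => [vx|vQ2|vQ3].
  + by move: xv; rewrite vx /comparable_sets subxx.
  + exact: (key Q2 Q3 H inQ Q2Q Q3Q v z3).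
  + apply: (key Q3 Q2 _ _ Q3Q Q2Q v z2) => //.
      by move=> s t sQ3 tQ2; rewrite comparable_setsC; apply: H.
    by move=> t /inQ[]; [constructor 1|constructor 3|constructor 2].
(* Series case, [Q2] below [Q3]. If [x] lies below a member of [Q2] it joins the lower part; if it
   lies above a member of [Q3] it joins the upper part. *)
- have [/existsP[z /andP[zQ xz]]|no2] :=
      boolP [exists z, (z \in Q2) && (x \subset z)].
    apply: (@decomposableI _ (fun t => t \notin Q3) q2 q3) => //.
      by apply/negP => q2Q3; move: (H _ _ q2Q q2Q3); rewrite properxx.
      by rewrite q3Q.
    right=> u v uQ vQ uQ3; rewrite negbK => vQ3.
    case: (inQ u uQ) => [->|uQ2|uQ3']; last by rewrite uQ3' in uQ3.
      exact: sub_proper_trans xz (H _ _ zQ vQ3).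
    exact: H.
  have [/existsP[z /andP[zQ xz]]|no3] :=
      boolP [exists z, (z \in Q3) && (z \subset x)].
    apply: (@decomposableI _ (mem Q2) q2 q3) => //=.
      by apply/negP => q3Q2; move: (H _ _ q3Q2 q3Q); rewrite properxx.
    right=> u v uQ vQ uQ2 vQ2; case: (inQ v vQ) => [->|vQ2'|vQ3].
    + exact: proper_sub_trans (H _ _ uQ2 zQ) xz.
    + by rewrite vQ2' in vQ2.
    + exact: H.
  have n2 z : z \in Q2 -> ~~ (x \subset z).
    by move=> zQ; apply: contra no2 => xz; apply/existsP; exists z; rewrite zQ.
  have n3 z : z \in Q3 -> ~~ (z \subset x).
    by move=> zQ; apply: contra no3 => xz; apply/existsP; exists z; rewrite zQ.
  (* If [x] is above all of [Q2] or below all of [Q3], it joins the opposite part. Otherwise there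
     are [v2] in [Q2] and [v3] in [Q3], both incomparable to [x]. *)
  have [/existsP[v2 /andP[v2Q xv2]]|all2] :=
      boolP [exists z, (z \in Q2) && ~~ (z \subset x)]; last first.
    apply: (@decomposableI _ (mem Q2) q2 x) => //=.
      by apply/negP => /Q2Q[]; rewrite eqxx.
    right=> u v uQ vQ uQ2 vQ2; case: (inQ v vQ) => [->|vQ2'|vQ3].
    + apply: properEsub; last by case: (Q2Q _ uQ2).
      by apply: contraR all2 => ux; apply/existsP; exists u; rewrite uQ2.
    + by rewrite vQ2' in vQ2.
    + exact: H.
  have [/existsP[v3 /andP[v3Q xv3]]|all3] :=
      boolP [exists z, (z \in Q3) && ~~ (x \subset z)]; last first.
    apply: (@decomposableI _ (fun t => t \notin Q3) x q3) => //=.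
      by apply/negP => /Q3Q[]; rewrite eqxx.
      by rewrite q3Q.
    right=> u v uQ vQ uQ3; rewrite negbK => vQ3.
    case: (inQ u uQ) => [->|uQ2|uQ3']; last by rewrite uQ3' in uQ3.
      apply: properEsub; last by rewrite eq_sym; case: (Q3Q _ vQ3).
      by apply: contraR all3 => ux; apply/existsP; exists v; rewrite vQ3.
    exact: H.
  have [v2x v2Q'] := Q2Q _ v2Q; have [v3x v3Q'] := Q3Q _ v3Q.
  (* The members of [Q2] below [x] form a lower series part: if such a [u] were not below some [v]
     in [Q2] with [v] not below [x], then [v], [u], [v3], [x] would be an N. The next case is dual,
     and if neither occurs [x] is isolated. *)
  have [/existsP[z /andP[zQ zx]]|no2'] :=
      boolP [exists z, (z \in Q2) && (z \subset x)].
    have [zx' zQ'] := Q2Q _ zQ.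
    apply: (@decomposableI _ (fun t => (t \in Q2) && (t \subset x)) z x);
      rewrite ?zQ ?zx //=.
      by apply/negP => /andP[/Q2Q[]]; rewrite eqxx.
    right=> u v uQ vQ /andP[uQ2 ux]; rewrite negb_and.
    case: (inQ v vQ) => [->|vQ2|vQ3] /= _H.
    + by apply: properEsub => //; case: (Q2Q _ uQ2).
    + move: _H; rewrite vQ2 /= => vx.
      apply: properEsub; last by apply: contraNneq vx => <-.
      apply/negPn/negP => uv; apply: nN.
      have vu : ~~ (v \subset u) by apply: contra vx => vu; apply: subset_trans vu ux.
      apply: (@contains_induced_NI Q v u v3 x) => //.
      * exact: proper_sub (H _ _ vQ2 v3Q).
      * exact: proper_sub (H _ _ uQ2 v3Q).
      * by rewrite /comparable_sets negb_or vu uv.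
      * by rewrite /comparable_sets negb_or vx n2.
      * by rewrite /comparable_sets negb_or n3 // xv3.
    + exact: H.
  have [/existsP[z /andP[zQ zx]]|no3'] :=
      boolP [exists z, (z \in Q3) && (x \subset z)].
    have [zx' zQ'] := Q3Q _ zQ.
    apply: (@decomposableI _ (fun t => ~~ ((t \in Q3) && (x \subset t))) x z);
      rewrite ?zQ ?zx //=.
      by apply/negP => /andP[/Q3Q[]]; rewrite eqxx.
    right=> v u vQ uQ _H; rewrite negbK => /andP[uQ3 xu]; move: _H; rewrite negb_and.
    case: (inQ v vQ) => [->|vQ2|vQ3] /= _H.
    + by apply: properEsub => //; rewrite eq_sym; case: (Q3Q _ uQ3).
    + exact: H.
    + move: _H; rewrite vQ3 /= => xv.
      apply: properEsub; last by apply: contraNneq xv => ->.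
      apply/negPn/negP => vu; apply: nN.
      have uv : ~~ (u \subset v) by apply: contra xv => uv; apply: subset_trans xu uv.
      apply: (@contains_induced_NI Q x v2 u v) => //.
      * exact: proper_sub (H _ _ v2Q uQ3).
      * exact: proper_sub (H _ _ v2Q vQ3).
      * by rewrite /comparable_sets negb_or xv2 n2.
      * by rewrite /comparable_sets negb_or xv n3.
      * by rewrite /comparable_sets negb_or vu uv.
  apply: (@decomposableI _ (pred1 x) x q2) => //=.
  left=> u v uQ vQ /eqP-> vx; case: (inQ v vQ) vx => [->|vQ2|vQ3]; rewrite ?eqxx // => _.
    rewrite negb_or n2 //=; apply: contra no2' => vx.
    by apply/existsP; exists v; rewrite vQ2.
  rewrite negb_or n3 // andbT; apply: contra no3' => vx.
  by apply/existsP; exists v; rewrite vQ3.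
Qed.

(** * Modules of a family and the way a copy of N meets them *)

Definition is_module F M := M \subset F /\
  forall x y z, x \in F -> x \notin M -> y \in M -> z \in M ->
    (x \subset y) = (x \subset z) /\ (y \subset x) = (z \subset x).

(* [N] is a prime poset. *)
Lemma N_meets_module F M a b c d y z : is_module F M ->
  a \in F -> b \in F -> c \in F -> d \in F -> is_induced_N a b c d ->
  y \in [:: a; b; c; d] -> z \in [:: a; b; c; d] -> y != z ->
  y \in M -> z \in M -> [/\ a \in M, b \in M, c \in M & d \in M].
Proof.
move=> [sM mM] aF bF cF dF; rewrite is_induced_NE.
case/and5P => ac bc bd /incomparableP[ab ba] /andP[].
move=> /incomparableP[ad da] /incomparableP[cd dc] yN zN nyz yM zM.
have up x u v : x \in F -> u \in M -> v \in M ->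
    u \subset x -> ~~ (v \subset x) -> x \in M.
  move=> xF uM vM ux vx; apply: contraNT vx => xM.
  by have [_ <-] := mM x u v xF xM uM vM.
have dn x u v : x \in F -> u \in M -> v \in M ->
    x \subset u -> ~~ (x \subset v) -> x \in M.
  move=> xF uM vM ux vx; apply: contraNT vx => xM.
  by have [<- _] := mM x u v xF xM uM vM.
have all_ab : a \in M -> b \in M -> [/\ a \in M, b \in M, c \in M & d \in M].
  move=> aM bM; have dM := up d b a dF bM aM bd ad.
  by have cM := up c a d cF aM dM ac dc.
have all_ac : a \in M -> c \in M -> [/\ a \in M, b \in M, c \in M & d \in M].
  by move=> aM cM; apply: all_ab => //; apply: (dn b c a).
have all_ad : a \in M -> d \in M -> [/\ a \in M, b \in M, c \in M & d \in M].
  by move=> aM dM; apply: all_ac => //; apply: (up c a d).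
have all_bc : b \in M -> c \in M -> [/\ a \in M, b \in M, c \in M & d \in M].
  by move=> bM cM; apply: all_ab => //; apply: (dn a c b).
have all_bd : b \in M -> d \in M -> [/\ a \in M, b \in M, c \in M & d \in M].
  by move=> bM dM; apply: all_bc => //; apply: (up c b d).
have all_cd : c \in M -> d \in M -> [/\ a \in M, b \in M, c \in M & d \in M].
  by move=> cM dM; apply: all_ac => //; apply: (dn a c d).
move: yN zN nyz yM zM; rewrite !inE => /or4P[]/eqP-> /or4P[]/eqP->;
  rewrite ?eqxx // => _ *; by
    [apply: all_ab | apply: all_ac | apply: all_ad | apply: all_bc
    | apply: all_bd | apply: all_cd].
Qed.

(** Since [S] looks like [q] from outside [M], [S |: M] is a module of [S |: F]. A copy of N lies
    entirely in it or meets it in at most one set; in the latter case that set can be replaced by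
    [q], which gives a copy in [F]. *)
Lemma contains_induced_N_module F M S q : is_module F M -> q \in M ->
    (forall x, x \in F -> x \notin M ->
       (x \subset S) = (x \subset q) /\ (S \subset x) = (q \subset x)) ->
  contains_induced_N (S |: F) -> contains_induced_N F \/ contains_induced_N (S |: M).
Proof.
move=> [sM mM] qM HS [a [b [c [d [aF bF cF dF N]]]]].
pose M' := S |: M.
have mod' : is_module (S |: F) M'.
  split; first exact: setUS.
  move=> x y z; rewrite !inE negb_or => /orP[-> //|xF] /andP[xS xM].
  have eq_q y' : (y' == S) || (y' \in M) ->
      (x \subset y') = (x \subset q) /\ (y' \subset x) = (q \subset x).
    by case/orP=> [/eqP->|yM]; [apply: HS | apply: mM].
  by move=> /eq_q[-> ->] /eq_q[-> ->].
have inF x : x \in S |: F -> x \notin M' -> x \in F.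
  by rewrite !inE negb_or => /orP[-> //|->].
have qM' : q \in M' by rewrite !inE qM orbT.
have qF : q \in F by apply: (subsetP sM).
have cmpq x y : x \in S |: F -> x \notin M' -> y \in M' ->
    (x \subset y) = (x \subset q) /\ (y \subset x) = (q \subset x).
  by move=> xF xM yM; apply: mod'.2.
have uN : uniq [:: a; b; c; d] by case/andP: N.
have [[aM bM cM dM]|none] :
    [/\ a \in M', b \in M', c \in M' & d \in M'] \/
    (forall y z, y \in [:: a; b; c; d] -> z \in [:: a; b; c; d] ->
      y \in M' -> z \in M' -> y = z).
  have [/existsP[y /existsP[z /and5P[yN zN yM zM nyz]]]|none] :=
      boolP [exists y, exists z, [&& y \in [:: a; b; c; d],
        z \in [:: a; b; c; d], y \in M', z \in M' & y != z]].
    by left; apply: (N_meets_module mod' aF bF cF dF N yN zN).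
  right=> y z yN zN yM zM; apply/eqP; apply: contraNT none => nyz.
  by apply/existsP; exists y; apply/existsP; exists z; rewrite yN zN yM zM.
  by right; exists a, b, c, d; split.
move: uN; rewrite /= !inE !negb_or !andbT => /and3P[/and3P[ab ac ad] /andP[bc bd] cd].
left; have := N; rewrite is_induced_NE /comparable_sets.
have excl y z : y \in [:: a; b; c; d] -> z \in [:: a; b; c; d] ->
    y \in M' -> y != z -> z \notin M'.
  by move=> yN zN yM; apply: contra => zM; apply/eqP; apply: none.
have [aM|aM] := boolP (a \in M').
  have bM : b \notin M' by apply: excl aM ab; rewrite !inE eqxx ?orbT.
  have cM : c \notin M' by apply: excl aM ac; rewrite !inE eqxx ?orbT.
  have dM : d \notin M' by apply: excl aM ad; rewrite !inE eqxx ?orbT.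
  have [e1 e1'] := cmpq b a bF bM aM; have [e2 e2'] := cmpq c a cF cM aM.
  have [e3 e3'] := cmpq d a dF dM aM.
  rewrite ?e1 ?e1' ?e2 ?e2' ?e3 ?e3'.
  by move=> N'; exists q, b, c, d; rewrite is_induced_NE; split=> //; apply: inF.
have [bM|bM] := boolP (b \in M').
  have cM : c \notin M' by apply: excl bM bc; rewrite !inE eqxx ?orbT.
  have dM : d \notin M' by apply: excl bM bd; rewrite !inE eqxx ?orbT.
  have [e1 e1'] := cmpq a b aF aM bM; have [e2 e2'] := cmpq c b cF cM bM.
  have [e3 e3'] := cmpq d b dF dM bM.
  rewrite ?e1 ?e1' ?e2 ?e2' ?e3 ?e3'.
  by move=> N'; exists a, q, c, d; rewrite is_induced_NE; split=> //; apply: inF.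
have [cM|cM] := boolP (c \in M').
  have dM : d \notin M' by apply: excl cM cd; rewrite !inE eqxx ?orbT.
  have [e1 e1'] := cmpq a c aF aM cM; have [e2 e2'] := cmpq b c bF bM cM.
  have [e3 e3'] := cmpq d c dF dM cM.
  rewrite ?e1 ?e1' ?e2 ?e2' ?e3 ?e3'.
  by move=> N'; exists a, b, q, d; rewrite is_induced_NE; split=> //; apply: inF.
have [dM|dM] := boolP (d \in M').
  have [e1 e1'] := cmpq a d aF aM dM; have [e2 e2'] := cmpq b d bF bM dM.
  have [e3 e3'] := cmpq c d cF cM dM.
  rewrite ?e1 ?e1' ?e2 ?e2' ?e3 ?e3'.
  by move=> N'; exists a, b, c, q; rewrite is_induced_NE; split=> //; apply: inF.
by move=> N'; exists a, b, c, d; rewrite is_induced_NE; split=> //; apply: inF.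
Qed.

End InducedN.

Section Saturation.
Variable T : finType.
Implicit Types (x y z S W A B C : {set T}) (F M Q R : {set {set T}}) (w : T -> rat).

(** * Components of a decomposed module are smaller modules *)

Lemma series_subF Q1 Q2 x y : series Q1 Q2 -> x \in Q1 -> y \in Q2 ->
  (x \subset y) /\ (y \subset x) = false.
Proof.
by move=> Q12 xQ yQ; move: (Q12 _ _ xQ yQ); rewrite properE => /andP[-> /negPf].
Qed.

Lemma parallel_subF Q1 Q2 x y : parallel Q1 Q2 -> x \in Q1 -> y \in Q2 ->
  (x \subset y) = false /\ (y \subset x) = false.
Proof.
by move=> Q12 xQ yQ; have [/negPf-> /negPf->] := incomparableP (Q12 _ _ xQ yQ).
Qed.

Lemma parallel_sym Q1 Q2 : parallel Q1 Q2 -> parallel Q2 Q1.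
Proof. by move=> Q12 x y xQ yQ; rewrite comparable_setsC; apply: Q12. Qed.

Lemma is_module_parallel F Q1 Q2 :
  is_module F (Q1 :|: Q2) -> parallel Q1 Q2 -> is_module F Q1.
Proof.
move=> [sQ mQ] Q12; split=> [|x y z xF xQ1 yQ zQ].
  exact: subset_trans (subsetUl _ _) sQ.
have [xQ2|xQ2] := boolP (x \in Q2); last first.
  by apply: mQ; rewrite // !inE ?negb_or ?xQ1 ?yQ ?zQ.
by have [-> ->] := parallel_subF Q12 yQ xQ2; have [-> ->] := parallel_subF Q12 zQ xQ2.
Qed.

Lemma is_module_series F Q1 Q2 :
  is_module F (Q1 :|: Q2) -> series Q1 Q2 -> is_module F Q1 /\ is_module F Q2.
Proof.
move=> [sQ mQ] Q12; split; split=> [|x y z xF xQ yQ zQ].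
- exact: subset_trans (subsetUl _ _) sQ.
- have [xQ2|xQ2] := boolP (x \in Q2); last first.
    by apply: mQ; rewrite // !inE ?negb_or ?xQ ?yQ ?zQ.
  by have [-> ->] := series_subF Q12 yQ xQ2; have [-> ->] := series_subF Q12 zQ xQ2.
- exact: subset_trans (subsetUr _ _) sQ.
- have [xQ1|xQ1] := boolP (x \in Q1); last first.
    by apply: mQ; rewrite // !inE ?negb_or ?xQ ?yQ ?zQ ?orbT ?xQ1.
  by have [-> ->] := series_subF Q12 xQ1 yQ; have [-> ->] := series_subF Q12 xQ1 zQ.
Qed.

Lemma is_module1 F x : x \in F -> is_module F [set x].
Proof.
move=> xF; split; first by rewrite sub1set.
by move=> y z t _ _ /set1P-> /set1P->.
Qed.

Lemma card_parallel Q1 Q2 x : parallel Q1 Q2 -> x \in Q2 -> #|Q1| < #|Q1 :|: Q2|.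
Proof.
move=> Q12 xQ2; apply: proper_card; rewrite properE subsetUl /=.
apply/subsetPn; exists x; first by rewrite inE xQ2 orbT.
by apply/negP => xQ1; move: (Q12 _ _ xQ1 xQ2); rewrite /comparable_sets subxx.
Qed.

Lemma card_series Q1 Q2 x y : series Q1 Q2 -> x \in Q1 -> y \in Q2 ->
  #|Q1| < #|Q1 :|: Q2| /\ #|Q2| < #|Q1 :|: Q2|.
Proof.
move=> Q12 xQ yQ; have dis z : z \in Q1 -> z \in Q2 -> False.
  by move=> zQ1 zQ2; move: (Q12 _ _ zQ1 zQ2); rewrite properxx.
split; apply: proper_card; rewrite properE ?subsetUl ?subsetUr /=; apply/subsetPn.
- by exists y; [rewrite inE yQ orbT | apply/negP => /dis/(_ yQ)].
- by exists x; [rewrite inE xQ | apply/negP; apply: dis].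
Qed.

(** Over ['I_n] this unfolds to [N_saturated]; the ground type is left arbitrary here. *)
Definition saturated F := ~ contains_induced_N F /\
  forall S, S \notin F -> contains_induced_N (S |: F).

(** The form in which saturation is exploited: to reach a contradiction it suffices to build [S] so
    that [S |: M] has no N. *)
Lemma saturated_module F M S q : saturated F -> is_module F M -> q \in M ->
    S \notin F ->
    (forall x, x \in F -> x \notin M ->
       (x \subset S) = (x \subset q) /\ (S \subset x) = (q \subset x)) ->
  contains_induced_N (S |: M).
Proof.
move=> [nN sat] mM qM /sat NS HS.
by have [] := contains_induced_N_module mM qM HS NS.
Qed.

(** * Signed weights of point sets *)

Definition weight w (A : {set T}) : rat := (\sum_(i in A) w i)%R.

Definition posp w W := [set i in W | 0 < w i]%R.

Lemma weightN w A : weight (fun i => - w i)%R A = (- weight w A)%R.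
Proof. by rewrite /weight sumrN. Qed.

Lemma weight_split w A B : B \subset A ->
  weight w A = (weight w B + weight w (A :\: B))%R.
Proof.
move=> sBA; rewrite /weight (big_setID B) /=; congr (_ + _)%R.
by rewrite (setIidPr sBA).
Qed.

Lemma weight_gt0 w A : A != set0 ->
  (forall i, i \in A -> 0 < w i)%R -> (0 < weight w A)%R.
Proof.
move=> /set0Pn[i iA] pos; rewrite /weight (bigD1 i) //=.
by apply: ltr_pwDl; [apply: pos | apply: sumr_ge0 => j /andP[jA _]; apply/ltW/pos].
Qed.

Lemma weight0_posp w W A : A \subset posp w W -> weight w A = 0%R -> A = set0.
Proof.
move=> sA w0; apply/eqP; apply/negPn/negP => A0.
suff : (0 < weight w A)%R by rewrite w0 ltxx.
by apply: weight_gt0 => // i /(subsetP sA); rewrite inE => /andP[].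
Qed.

Lemma weight_ge0_posp w W A : (forall i, i \in W -> w i != 0%R) -> A \subset W ->
  A != set0 -> (0 <= weight w A)%R -> posp w W :&: A != set0.
Proof.
move=> w0 sAW A0; apply: contraTneq => P0; rewrite -ltNge -oppr_gt0 -weightN.
apply: weight_gt0 => // i iA; have iW := subsetP sAW _ iA.
rewrite oppr_gt0 lt_neqAle w0 //= leNgt; apply/negP => wi.
by have := in_set0 i; rewrite -P0 !inE iW wi iA.
Qed.

(** The difference [B :\: A] has nonnegative weight but contains only points of negative weight, so
    it is empty. *)
Lemma weight0_sup w W A B : (forall i, i \in W -> w i != 0%R) ->
  A \subset B -> B \subset W -> posp w W :&: B \subset A ->
  weight w A = 0%R -> (0 <= weight w B)%R -> A = B.
Proof.
move=> w0 sAB sBW sPA wA; rewrite (weight_split w sAB) wA add0r => wB.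
apply/eqP; rewrite eqEsubset sAB /= -setD_eq0; apply/negPn/negP => D0.
have sDW : B :\: A \subset W by apply: subset_trans sBW; apply: subsetDl.
have /set0Pn[i] := weight_ge0_posp w0 sDW D0 wB.
rewrite in_setI in_setD => /and3P[iP iA iB].
by case/negP: iA; apply: (subsetP sPA); rewrite in_setI iP.
Qed.

(** [W] need not be the whole support of [w]: passing to a submodule may shrink it to the points
    that the submodule covers. *)
Definition balanced w F M W := [/\ is_module F M, W != set0,
  (forall i, i \in W -> w i != 0%R),
  (forall x, x \in M -> weight w (x :&: W) = 0%R) &
  exists A C, [/\ A \in M, C \in M, A \subset C, A :&: W = set0 & W \subset C]].

(** Allows the sign of [w] to be chosen when only one sign of a total weight can be handled
    directly. *)
Lemma balancedN w F M W :
  balanced (fun i => - w i)%R F M W -> balanced w F M W.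
Proof.
move=> [mM W0 w0 wM AC]; split=> // [i iW|x xM].
  by rewrite -oppr_eq0 w0.
by apply: oppr_inj; rewrite -weightN wM // oppr0.
Qed.

Lemma sub_cover Q x : x \in Q -> x \subset cover Q.
Proof. exact: bigcup_sup. Qed.

Lemma cover_sub Q y : (forall x, x \in Q -> x \subset y) -> cover Q \subset y.
Proof. by move=> H; apply/bigcupsP. Qed.

(** * Submodules lying below a fixed member [C] of a module *)

Section Below.
Variables (w : T -> rat) (F M : {set {set T}}) (W C : {set T}).
Hypotheses (satF : saturated F) (mM : is_module F M).
Hypothesis w0 : forall i, i \in W -> w i != 0%R.
Hypothesis wM : forall x, x \in M -> weight w (x :&: W) = 0%R.
Hypothesis CM : C \in M.

(** If [x] is in [M], its trace on [W] consists of positive points and has weight 0, hence is empty.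
    If [x] is outside [M], it is below [C] and therefore below every member of the module. *)
Lemma below_posp S x : S \subset C -> S :&: W \subset posp w W ->
  x \in F -> x \subset S ->
  (x \in M -> x :&: W = set0) /\ (x \notin M -> forall y, y \in M -> x \subset y).
Proof.
move=> sSC sSW xF xS; split=> [xM|xM y yM].
  by apply: (@weight0_posp w W) (wM xM); apply: subset_trans sSW; apply: setSI.
by have [<- _] := mM.2 x C y xF xM CM yM; apply: subset_trans sSC.
Qed.

(** If [S] were in [F], [below_posp] applied to [S] itself would make its trace on [W] empty, either
    directly or through [S \subset y]. *)
Lemma notin_posp S y : S \subset C -> S :&: W \subset posp w W ->
  S :&: W != set0 -> y \in M -> y :&: W = set0 -> S \notin F.
Proof.
move=> sSC sSW S0 yM yW; apply/negP => SF.
have [S1 S2] := below_posp sSC sSW SF (subxx S).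
have [SM|SM] := boolP (S \in M); first by rewrite S1 ?eqxx in S0.
by case/negP: S0; rewrite -subset0 -yW; apply/setSI/S2.
Qed.

(** Enlarging a largest member [A] of [R] by the positive points of [cover Q] gives a twin [S] of
    [A]. It is new because [Y] supplies a positive point, and saturation would then place an N
    inside the two-element family of [S] and [A]. *)
Lemma parallel_below Q R R' Y : is_module F Q -> Q \subset M ->
  (forall q, q \in Q -> q \subset C) ->
  Q = R :|: R' -> R != set0 -> parallel R R' ->
  (forall x, x \in R -> x :&: W = set0) ->
  Y \in Q -> Y :&: W != set0 -> False.
Proof.
move=> mQ sQM QC QE /set0Pn[r rR] RR' R0 YQ YW.
case: (arg_maxnP (fun x : {set T} => #|x|) rR) => A mAR maxA.
have {mAR}AR : A \in R := mAR.
have AQ : A \in Q by rewrite QE inE AR.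
have AM := subsetP sQM _ AQ; have AF := subsetP mM.1 _ AM.
(* [S] and [A] compare in the same way with every other member. *)
pose S := A :|: posp w W :&: cover Q.
have sAS : A \subset S by apply: subsetUl.
have sScov : S \subset cover Q by rewrite subUset sub_cover //= subsetIr.
have sSC : S \subset C by apply: subset_trans sScov (cover_sub QC).
have SW : S :&: W \subset posp w W.
  by rewrite setIUl R0 // set0U -setIA subsetIl.
have S0 : S :&: W != set0.
  have /set0Pn[i] : posp w W :&: (Y :&: W) != set0.
    by apply: weight_ge0_posp; rewrite ?subsetIr // wM // (subsetP sQM).
  rewrite !in_setI => /and3P[iP iY iW]; apply/set0Pn; exists i.
  by rewrite in_setI iW andbT in_setU in_setI iP (subsetP (sub_cover YQ)) // orbT.
have SF : S \notin F by apply: (notin_posp sSC SW S0 AM); apply: R0.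
have [|a [b [c [d [aS bS cS dS]]]]] :=
    saturated_module satF (is_module1 AF) (set11 A) SF.
  move=> x xF; rewrite inE => xA.
  split.
    apply/idP/idP => [xS|xA']; last exact: subset_trans xA' sAS.
    have [{}x1 {}x2] := below_posp sSC SW xF xS.
    have [xM|xM] := boolP (x \in M); last exact: x2.
    apply/subsetP=> i ix; have := subsetP xS _ ix.
    rewrite !inE => /orP[//|/andP[/andP[iW _] _]].
    by have := in_set0 i; rewrite -(x1 xM) inE ix iW.
  apply/idP/idP => [Sx|Ax]; first exact: subset_trans sAS Sx.
  (* A member of [F] strictly above [A] is not in [R] by maximality, nor in [R'] by parallelism.
     Being outside the module [Q], it contains all of [cover Q]. *)
  have xQ : x \notin Q.
    rewrite QE inE negb_or; apply/andP; split; apply/negP => xR.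
      case/negP: xA; rewrite eq_sym eqEcard Ax /=; exact: maxA.
    by have [] := parallel_subF RR' AR xR; rewrite Ax.
  apply: subset_trans sScov (cover_sub _) => q qQ.
  by have [_ <-] := mQ.2 x A q xF xQ AQ qQ.
rewrite /is_induced_N => /andP[uN _].
have /(uniq_leq_size uN) // : {subset [:: a; b; c; d] <= [:: S; A]}.
move=> x; rewrite !inE => /or4P[] /eqP->; first by move: aS; rewrite !inE.
- by move: bS; rewrite !inE.
- by move: cS; rewrite !inE.
- by move: dS; rewrite !inE.
Qed.


(** If some [c] in [Q2] contains every positive point of [cover Q2], then [weight0_sup] shows that
    [c] contains all of [cover Q2 :&: W], and [q1], [c] are the required pair. Otherwise a set [S]
    can be added without creating an N, against saturation. *)
Lemma series_below Q1 Q2 q1 q2 : is_module F (Q1 :|: Q2) -> Q1 :|: Q2 \subset M ->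
  (forall q, q \in Q1 :|: Q2 -> q \subset C) ->
  q1 \in Q1 -> q2 \in Q2 -> series Q1 Q2 ->
  (forall x, x \in Q1 -> x :&: W = set0) ->
  (forall x, x \in Q2 -> x :&: W != set0) ->
  (0 <= weight w (cover Q2 :&: W))%R ->
  balanced w F (Q1 :|: Q2) (cover Q2 :&: W).
Proof.
move=> mQ sQM QC q1Q q2Q Q12 W1 W2 wge0.
have sub1 x : x \in Q1 -> x \in Q1 :|: Q2 by rewrite inE => ->.
have sub2 x : x \in Q2 -> x \in Q1 :|: Q2 by rewrite inE orbC => ->.
have covW x : x \in Q1 :|: Q2 -> x :&: (cover Q2 :&: W) = x :&: W.
  move=> xQ; suff /setIidPl xc : x \subset cover Q2 by rewrite setIA xc.
  case/setUP: xQ => xQ; last exact: sub_cover.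
  by apply: subset_trans (sub_cover q2Q); have [] := series_subF Q12 xQ q2Q.
have Wne : cover Q2 :&: W != set0.
  by have := W2 _ q2Q; apply: contraNneq => cov0; rewrite -covW ?cov0 ?setI0 ?sub2.
have w0' i : i \in cover Q2 :&: W -> w i != 0%R by move=> /setIP[_ /w0].
have wQ x : x \in Q1 :|: Q2 -> weight w (x :&: (cover Q2 :&: W)) = 0%R.
  by move=> xQ; rewrite covW // wM // (subsetP sQM).
have [/existsP[c /andP[cQ Pc]]|noc] :=
    boolP [exists c, (c \in Q2) && (posp w W :&: cover Q2 \subset c)].
  split=> //; exists q1, c; split; rewrite ?(sub1 _ q1Q) ?(sub2 _ cQ) //.
  - by have [] := series_subF Q12 q1Q cQ.
  - by rewrite covW ?W1 ?sub1.
  - rewrite -(@weight0_sup w W (c :&: W) (cover Q2 :&: W)) ?subsetIl ?subsetIr //.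
    + by apply: setSI; apply: sub_cover.
    + rewrite subsetI; apply/andP; split.
        by apply: subset_trans Pc; apply: setIS; apply: subsetIl.
      by rewrite setIA; apply: subsetIr.
    + by rewrite wM // (subsetP sQM) // sub2.
(* [S] lies above [Q1] and is incomparable to every element of [Q2]. *)
pose S := cover Q1 :|: posp w W :&: cover Q2.
have cov1 x : x \in Q2 -> cover Q1 \subset x.
  by move=> xQ; apply: cover_sub => y yQ; have [] := series_subF Q12 yQ xQ.
have cov1W : cover Q1 :&: W = set0.
  apply/setP => i; rewrite !inE; apply/negP => /andP[/bigcupP[x xQ ix] iW].
  by have := in_set0 i; rewrite -(W1 x xQ) inE ix iW.
have sS2 : S \subset cover Q2.
  by rewrite subUset subsetIr andbT; apply: subset_trans (cov1 _ q2Q) (sub_cover q2Q).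
have sSC : S \subset C by apply: subset_trans sS2 (cover_sub _) => q /sub2/QC.
have SW : S :&: W \subset posp w W by rewrite setIUl cov1W set0U -setIA subsetIl.
have S1 x : x \in Q1 -> x \subset S.
  by move=> xQ; apply: subset_trans (sub_cover xQ) (subsetUl _ _).
have S0 : S :&: W != set0.
  have /set0Pn[i] : posp w W :&: (q2 :&: W) != set0.
    apply: weight_ge0_posp; rewrite ?subsetIr ?W2 // wM // (subsetP sQM) //.
    exact: sub2.
  rewrite !in_setI => /and3P[iP iY iW]; apply/set0Pn; exists i.
  by rewrite in_setI iW andbT in_setU in_setI iP (subsetP (sub_cover q2Q)) // orbT.
have q1M : q1 \in M by apply/(subsetP sQM)/sub1.
have SF : S \notin F by apply: (notin_posp sSC SW S0 q1M); apply: W1.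
have xS_cov x : x :&: W = set0 -> x \subset S -> x \subset cover Q1.
  move=> xW xS; apply/subsetP=> i ix; have := subsetP xS _ ix.
  rewrite in_setU in_setI => /orP[//|/andP[]]; rewrite inE => /andP[iW _] _.
  by have := in_set0 i; rewrite -xW inE ix iW.
have inc2 x : x \in Q2 -> ~~ comparable_sets x S.
  move=> xQ; rewrite negb_or; apply/andP; split; apply/negP => h.
    have xM : x \in M by apply/(subsetP sQM)/sub2.
    have [/(_ xM)] := below_posp sSC SW (subsetP mM.1 _ xM) h.
    by move=> /eqP; rewrite (negPf (W2 _ xQ)).
  case/negP: noc; apply/existsP; exists x; rewrite xQ /=.
  by apply: subset_trans h; apply: subsetUr.
have [x xF xQ|a [b [c [d [aS bS cS dS]]]]] :=
    saturated_module satF mQ (sub1 _ q1Q) SF.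
  have mx q := fun h => mQ.2 x q1 q xF xQ (sub1 _ q1Q) h.
  split; apply/idP/idP => [xS|xq1]; last 1 first.
  - apply: subset_trans (cover_sub _) => [|q qQ]; first exact: sS2.
    by have [_ <-] := mx q (sub2 _ qQ).
  - have [x1 x2] := below_posp sSC SW xF xS.
    have [xM|xM] := boolP (x \in M); last exact: x2.
    have [-> _] := mx q2 (sub2 _ q2Q).
    by apply: subset_trans (cov1 _ q2Q); apply: xS_cov => //; apply: x1.
  - exact: subset_trans xq1 (S1 _ q1Q).
  - exact: subset_trans (S1 _ q1Q) xS.
move=> N; exfalso; apply: satF.1.
have [uN ac bc bd /and3P[ab ad cd]] := and5P N.
have inSQ x : x \in S |: (Q1 :|: Q2) -> x \notin Q1 -> x = S \/ x \in Q2.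
  by rewrite !inE => /or3P[/eqP|->|]; auto.
have cmp1 x y : x \in Q1 -> y \in S |: (Q1 :|: Q2) -> y \notin Q1 ->
    comparable_sets x y.
  move=> xQ yS /(inSQ y yS)[->|yQ]; rewrite /comparable_sets ?S1 //.
  by have [->] := series_subF Q12 xQ yQ.
(* The incomparable pairs of an N connect its four sets, so they lie all in [Q1] or all outside it.
   In the second case none is [S], since each is in a strict inclusion and [S] is incomparable to
   all of [Q2]. Either way the N is already in [F]. *)
have side x y : x \in S |: (Q1 :|: Q2) -> y \in S |: (Q1 :|: Q2) ->
    ~~ comparable_sets x y -> (x \in Q1) = (y \in Q1).
  move=> xS yS; apply: contraNeq.
  have [xQ|xQ] := boolP (x \in Q1); have [yQ|yQ] := boolP (y \in Q1) => // _.
    exact: cmp1.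
  by rewrite comparable_setsC; apply: cmp1.
have isol x y : x \in S |: (Q1 :|: Q2) -> y \in S |: (Q1 :|: Q2) ->
    x \notin Q1 -> y \notin Q1 -> x \proper y -> x \in Q2 /\ y \in Q2.
  move=> xS yS xQ yQ xy.
  case: (inSQ x xS xQ) (inSQ y yS yQ) xy => [->|xQ2] [->|yQ2] xy //.
  - by rewrite properxx in xy.
  - by case/negP: (inc2 _ yQ2); rewrite /comparable_sets (proper_sub xy) orbT.
  - by case/negP: (inc2 _ xQ2); rewrite /comparable_sets (proper_sub xy).
have QF x : x \in Q1 :|: Q2 -> x \in F by apply: (subsetP mQ.1).
exists a, b, c, d; have eab := side _ _ aS bS ab; have ead := side _ _ aS dS ad.
have ecd := side _ _ cS dS cd.
have [aQ|aQ] := boolP (a \in Q1).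
  by split=> //; apply: QF; apply: sub1; rewrite -?eab ?ecd -?ead.
have bQ : b \notin Q1 by rewrite -eab.
have dQ : d \notin Q1 by rewrite -ead.
have cQ : c \notin Q1 by rewrite ecd.
have [aQ2 cQ2] := isol _ _ aS cS aQ cQ ac; have [bQ2 dQ2] := isol _ _ bS dS bQ dQ bd.
by split=> //; apply: QF; apply: sub2.
Qed.

End Below.

(** Induction on [Q] through its decomposition. A parallel one is excluded by [parallel_below]; in a
    series one the lower part avoids [W] and every member of the upper part meets it, so
    [series_below] makes [Q] a balanced module smaller than [M]. *)
Lemma module_below_disjoint w F M W C : saturated F -> is_module F M ->
    (forall i, i \in W -> w i != 0%R) ->
    (forall x, x \in M -> weight w (x :&: W) = 0%R) -> C \in M ->
    (forall Q W', #|Q| < #|M| -> ~ balanced w F Q W') ->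
  forall Q A, is_module F Q -> Q \subset M -> C \notin Q ->
    (forall q, q \in Q -> q \subset C) -> A \in Q -> A :&: W = set0 ->
  forall x, x \in Q -> x :&: W = set0.
Proof.
move=> satF mM w0 wM CM noB Q; have [k] := ubnP #|Q|.
elim: k Q => // k IH Q ltQ A mQ sQM CQ QC AQ AW x xQ.
apply/eqP; apply/negPn/negP => xW.
have Q1 : 1 < #|Q|.
  apply/card_gt1P; exists A, x; split=> //.
  by apply: contraNneq xW => <-; rewrite AW.
have nNQ : ~ contains_induced_N Q.
  by move=> /(contains_induced_N_sub mQ.1); apply: satF.1.
have [R1 [R2 [QE R10 R20 R12]]] := N_free_decomposable Q1 nNQ.
have sub1 q : q \in R1 -> q \in Q by rewrite QE inE => ->.
have sub2 q : q \in R2 -> q \in Q by rewrite QE inE orbC => ->.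
have ind R B : #|R| < #|Q| -> is_module F R -> (forall q, q \in R -> q \in Q) ->
    B \in R -> B :&: W = set0 -> forall y, y \in R -> y :&: W = set0.
  move=> ltR mR sR BR BW; apply: (IH R _ B) => //.
  - exact: leq_trans ltR ltQ.
  - by apply/subsetP => q /sR /(subsetP sQM).
  - by apply: contra CQ => /sR.
  - by move=> q /sR/QC.
have [r1 r1R] := set0Pn _ R10; have [r2 r2R] := set0Pn _ R20.
case: R12 => R12.
  have mQ' := mQ; rewrite QE in mQ'.
  have m1 := is_module_parallel mQ' R12; rewrite setUC in mQ'.
  have m2 := is_module_parallel mQ' (parallel_sym R12).
  have [AR|AR] : A \in R1 \/ A \in R2 by apply/setUP; rewrite -QE.
    apply: (parallel_below satF mM w0 wM CM mQ sQM QC QE R10 R12 _ xQ xW).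
    apply: (ind _ A) => //; rewrite QE; exact: card_parallel R12 r2R.
  have QE' : Q = R2 :|: R1 by rewrite setUC.
  apply: (parallel_below satF mM w0 wM CM mQ sQM QC QE' R20 (parallel_sym R12) _ xQ xW).
  apply: (ind _ A) => //; rewrite QE'; exact: card_parallel (parallel_sym R12) r1R.
have mQ' := mQ; rewrite QE in mQ'.
have [m1 m2] := is_module_series mQ' R12.
have [lt1 lt2] := card_series R12 r1R r2R; rewrite -QE in lt1 lt2.
have [B BR BW] : exists2 B, B \in R1 & B :&: W = set0.
  have [AR|AR] : A \in R1 \/ A \in R2 by apply/setUP; rewrite -QE.
    by exists A.
  exists r1 => //; apply/eqP; rewrite -subset0 -AW; apply: setSI.
  by have [] := series_subF R12 r1R AR.
have R1W := ind R1 B lt1 m1 sub1 BR BW.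
have xR2 : x \in R2.
  by move: xQ; rewrite {1}QE => /setUP[/R1W|//] x0; rewrite x0 eqxx in xW.
have R2W y : y \in R2 -> y :&: W != set0.
  move=> yR; apply: contraNneq xW => yW; apply/eqP.
  exact: (ind R2 y).
have sQM' := sQM; rewrite QE in sQM'.
have ltQM : #|Q| < #|M|.
  by apply: proper_card; rewrite properE sQM; apply/subsetPn; exists C.
(* A negative total is handled by running [series_below] with the opposite weight. *)
have [wge0|wlt0] := lerP 0%R (weight w (cover R2 :&: W)).
  apply: (noB Q (cover R2 :&: W)) => //; rewrite {1}QE.
  by apply: (series_below satF mM w0 wM CM mQ' sQM' _ r1R r2R) => // q;
    rewrite -QE; apply: QC.
apply: (noB Q (cover R2 :&: W)) => //; apply: balancedN; rewrite {1}QE.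
apply: (@series_below _ F M W C satF mM _ _ CM _ _ r1 r2) => //.
- by move=> i iW; rewrite oppr_eq0 w0.
- by move=> y yM; rewrite weightN wM ?oppr0.
- by move=> q; rewrite -QE; apply: QC.
- by rewrite weightN oppr_ge0 ltW.
Qed.

(** * Duality under complementation of every member *)

Definition compl F := (@setC T) @^-1: F.

Lemma in_compl F x : (x \in compl F) = (~: x \in F).
Proof. by rewrite inE. Qed.

Lemma complK : involutive compl.
Proof. by move=> F; apply/setP => x; rewrite !in_compl setCK. Qed.

Lemma card_compl F : #|compl F| = #|F|.
Proof. by apply: card_preimset; apply: setC_inj. Qed.

(** N is self-dual: reversing inclusion exchanges [a] with [d] and [b] with [c]. *)
Lemma contains_induced_N_compl F : contains_induced_N F -> contains_induced_N (compl F).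
Proof.
move=> [a [b [c [d [aF bF cF dF]]]]]; rewrite is_induced_NE.
case/and5P => ac bc bd ab /andP[ad cd].
by apply: (@contains_induced_NI _ _ (~: d) (~: c) (~: b) (~: a));
  rewrite ?in_compl ?setCK ?setCS // /comparable_sets !setCS // orbC.
Qed.

Lemma saturated_compl F : saturated F -> saturated (compl F).
Proof.
move=> [nN sat]; split=> [/contains_induced_N_compl|S].
  by rewrite complK.
rewrite in_compl => /sat/contains_induced_N_compl.
suff -> : compl (~: S |: F) = S |: compl F by [].
by apply/setP => x; rewrite in_compl !inE (inj_eq (@setC_inj T)).
Qed.

Lemma is_module_compl F M : is_module F M -> is_module (compl F) (compl M).
Proof.
move=> [sM mM]; split; first exact: preimsetS.
move=> x y z; rewrite !in_compl => xF xM yM zM.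
by rewrite -(setCS y x) -(setCS x y) -(setCS z x) -(setCS x z);
  have [-> ->] := mM _ _ _ xF xM yM zM.
Qed.

Lemma weight_setC w W x : weight w (~: x :&: W) = (weight w W - weight w (x :&: W))%R.
Proof.
rewrite (@weight_split w W (x :&: W)) ?subsetIr // addrC addKr; congr weight.
by apply/setP => i; rewrite !inE; case: (i \in x); case: (i \in W).
Qed.

(** As [W] is the trace of [C], it has weight 0, so complementary traces have weight 0 too; [A] and
    [C] exchange roles. *)
Lemma balanced_compl w F M W : balanced w F M W -> balanced w (compl F) (compl M) W.
Proof.
move=> [mM W0 w0 wM [A [C [AM CM AC AW WC]]]]; split=> //.
- exact: is_module_compl.
- move=> x; rewrite in_compl => xM; rewrite -[x]setCK weight_setC wM // subr0.
  by rewrite -(wM C CM) (setIidPr WC).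
exists (~: C), (~: A); rewrite !in_compl !setCK setCS; split=> //.
  by rewrite setIC -setDE; apply/eqP; rewrite setD_eq0.
by rewrite subsetC -disjoints_subset -setI_eq0 AW.
Qed.

(** Induction on the size of [M]. In a parallel composition the nested sets [A] and [C] share a
    component, which is then a smaller balanced module; the series case is refuted by a set placed
    between the two components. *)
Lemma saturated_not_balanced w F M W : saturated F -> ~ balanced w F M W.
Proof.
move=> satF; have [k] := ubnP #|M|; elim: k M W => // k IH M W ltM.
move=> B; have [mM W0 w0 wM [A [C [AM CM AC AW WC]]]] := B.
have noB Q W' : #|Q| < #|M| -> ~ balanced w F Q W'.
  by move=> ltQ; apply: IH; apply: leq_trans ltQ ltM.
have M1 : 1 < #|M|.
  apply/card_gt1P; exists A, C; split=> //.
  by apply: contraNneq W0 => AC'; rewrite -subset0 -AW AC' subsetI WC subxx.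
have nNM : ~ contains_induced_N M.
  by move=> /(contains_induced_N_sub mM.1); apply: satF.1.
have [M2 [M3 [ME /set0Pn[m2 m2M] /set0Pn[m3 m3M] H]]] := N_free_decomposable M1 nNM.
have mM' := mM; rewrite ME in mM'.
have sub2 q : q \in M2 -> q \in M by rewrite ME inE => ->.
have sub3 q : q \in M3 -> q \in M by rewrite ME inE orbC => ->.
have inM q : q \in M -> q \in M2 \/ q \in M3 by rewrite {1}ME => /setUP.
case: H => H.
  have mM'' := mM'; rewrite setUC in mM''.
  case: (inM A AM) (inM C CM) => [A2|A3] [C2|C3].
  - apply: (noB M2 W); first by rewrite ME; apply: card_parallel H m3M.
    split=> //; [exact: is_module_parallel mM' H| by move=> x /sub2/wM |].
    by exists A, C.
  - by have [] := parallel_subF H A2 C3; rewrite AC.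
  - by have [_] := parallel_subF H C2 A3; rewrite AC.
  - have H' := parallel_sym H.
    apply: (noB M3 W); first by rewrite ME setUC; apply: card_parallel H' m2M.
    split=> //; [exact: is_module_parallel mM'' H'| by move=> x /sub3/wM |].
    by exists A, C.
have [mod2 mod3] := is_module_series mM' H.
have dis x : x \in M2 -> x \notin M3.
  by move=> x2; apply/negP => x3; move: (H _ _ x2 x3); rewrite properxx.
have [A' A'2 A'W] : exists2 A', A' \in M2 & A' :&: W = set0.
  case: (inM A AM) => AM'; first by exists A.
  exists m2 => //; apply/eqP; rewrite -subset0 -AW; apply: setSI.
  by have [] := series_subF H m2M AM'.
have [C' C'3 WC'] : exists2 C', C' \in M3 & W \subset C'.
  case: (inM C CM) => CM'; last by exists C.
  exists m3 => //; apply: subset_trans WC _.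
  by have [] := series_subF H CM' m3M.
have W2 x : x \in M2 -> x :&: W = set0.
  apply: (module_below_disjoint satF mM w0 wM (sub3 _ C'3) noB mod2 _ _ _ A'2) => //.
  - exact/subsetP.
  - by apply: contraL C'3; apply: dis.
  - by move=> q q2; have [] := series_subF H q2 C'3.
(* The dual of [W2], obtained from [module_below_disjoint] for the complemented family. *)
have W3 x : x \in M3 -> W \subset x.
  move=> x3; have := @module_below_disjoint w (compl F) (compl M) W (~: A')
    (saturated_compl satF) (is_module_compl mM) w0.
  have [_ _ _ wM' _] := balanced_compl B.
  move=> /(_ wM'); rewrite in_compl setCK => /(_ (sub2 _ A'2)).
  have noB' Q W' : #|Q| < #|compl M| -> ~ balanced w (compl F) Q W'.
    rewrite card_compl -(card_compl Q) => ltQ /balanced_compl; rewrite complK.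
    exact: noB.
  move=> /(_ noB' (compl M3) (~: C') (is_module_compl mod3)).
  rewrite !in_compl !setCK C'3 dis // => D.
  have /(_ (~: x)) : forall y, y \in compl M3 -> y :&: W = set0.
    apply: D => //.
    - by apply: preimsetS; apply/subsetP.
    - move=> q; rewrite in_compl => q3; rewrite -setCS setCK.
      by have [] := series_subF H A'2 q3.
    - by rewrite setIC -setDE; apply/eqP; rewrite setD_eq0.
  rewrite in_compl setCK => /(_ x3)/eqP.
  by rewrite setIC -setDE setD_eq0.
pose S := cover M2 :|: posp w W.
have S2 x : x \in M2 -> x \subset S.
  by move=> xM; apply: subset_trans (sub_cover xM) (subsetUl _ _).
have S3 x : x \in M3 -> S \subset x.
  move=> xM; rewrite subUset; apply/andP; split.
    by apply: cover_sub => y yM; have [] := series_subF H yM xM.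
  apply: subset_trans (W3 _ xM); apply/subsetP => i; by rewrite inE => /andP[].
have SW : S :&: W = posp w W.
  apply/setP => i; rewrite in_setI in_setU [i \in posp _ _]inE.
  case: (boolP (i \in W)) => iW; rewrite ?andbF //= andbT orb_idl // => /bigcupP[y yM iy].
  by have := in_set0 i; rewrite -(W2 y yM) inE iy iW.
have wW : weight w W = 0%R by rewrite -(wM C CM) (setIidPr WC).
have P0 : posp w W != set0.
  have := @weight_ge0_posp w W W w0 (subxx W) W0; rewrite wW => /(_ (lexx _)).
  by apply: contraNneq => ->; rewrite set0I.
have SM : S \notin M.
  apply: contraNN P0 => SM; apply/eqP.
  by apply: (@weight0_posp w W) => //; rewrite -SW wM.
have SF : S \notin F.
  apply/negP => SF; have [e _] := mM.2 S C' A' SF SM (sub3 _ C'3) (sub2 _ A'2).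
  move: e; rewrite S3 // => /esym SA; case/negP: SM.
  have -> : S = A' by apply/eqP; rewrite eqEsubset SA S2.
  exact: sub2.
have [x xF xM|a [b [c [d [aS bS cS dS N]]]]] :=
    saturated_module satF mM (sub2 _ A'2) SF.
  have [e1 e2] := mM.2 x C' A' xF xM (sub3 _ C'3) (sub2 _ A'2).
  split; apply/idP/idP => h.
  - by rewrite -e1; apply: subset_trans h (S3 _ C'3).
  - exact: subset_trans h (S2 _ A'2).
  - exact: subset_trans (S2 _ A'2) h.
  - by rewrite -e2 in h; apply: subset_trans (S3 _ C'3) h.
apply: nNM; exists a, b, c, d.
have [_ _ _ _ /and3P[ab ad cd]] := and5P N.
(* [S] is comparable to all of [M], while each set of an N is incomparable to another one; so the N
   avoids [S]. *)
have cS' x y : x \in S |: M -> y \in S |: M -> ~~ comparable_sets x y ->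
    x \in M /\ y \in M.
  have cmpS z : z \in S |: M -> comparable_sets S z.
    rewrite !inE => /orP[/eqP->|/inM[zM|zM]]; rewrite /comparable_sets ?subxx //.
      by rewrite S2 ?orbT.
    by rewrite S3.
  move=> xS yS; have [->|xne] := eqVneq x S; first by rewrite cmpS.
  have [->|yne] := eqVneq y S; first by rewrite comparable_setsC cmpS.
  by move: xS yS; rewrite !inE (negPf xne) (negPf yne).
have [aM bM] := cS' _ _ aS bS ab; have [cM dM] := cS' _ _ cS dS cd.
by split.
Qed.

(** * Linear independence and the size bound *)

Lemma saturated_extremes F : saturated F -> set0 \in F /\ setT \in F.
Proof.
move=> [nN sat].
(* A set comparable to every set can take no part in an N, so adding it creates none. *)
have cmpF S : (forall x, comparable_sets S x) -> S \in F.
  move=> cS; apply/negPn/negP => /sat[a [b [c [d [aS bS cS' dS N]]]]].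
  have [_ _ _ _ /and3P[ab ad cd]] := and5P N.
  have inF x y : x \in S |: F -> y \in S |: F -> ~~ comparable_sets x y ->
      x \in F /\ y \in F.
    move=> xS yS; have [->|xne] := eqVneq x S; first by rewrite cS.
    have [->|yne] := eqVneq y S; first by rewrite comparable_setsC cS.
    by move: xS yS; rewrite !inE (negPf xne) (negPf yne).
  have [aF bF] := inF _ _ aS bS ab; have [cF dF] := inF _ _ cS' dS cd.
  by apply: nN; exists a, b, c, d.
by split; apply: cmpF => x; rewrite /comparable_sets ?sub0set ?subsetT ?orbT.
Qed.

(** Otherwise [F] itself, as a module, is balanced over the support of [w], with [set0] and [setT]
    as the nested pair. *)
Lemma saturated_weight_eq0 w F : saturated F ->
  (forall x, x \in F -> weight w x = 0%R) -> forall i, w i = 0%R.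
Proof.
move=> satF wF i; apply/eqP; apply/negPn/negP => wi.
have [F0 FT] := saturated_extremes satF.
pose W := [set j | w j != 0%R].
apply: (@saturated_not_balanced w F F W satF); split.
- by split=> // x y z xF; rewrite xF.
- by apply/set0Pn; exists i; rewrite inE.
- by move=> j; rewrite inE.
- move=> x xF; rewrite -[RHS](wF x xF) /weight big_mkcond [RHS]big_mkcond.
  apply: eq_bigr => j _; rewrite !inE; case: (j \in x) => //=.
  by case: eqVneq.
exists set0, setT; split; rewrite ?sub0set ?subsetT ?set0I //.
Qed.

End Saturation.

(** With fewer than [n] nonempty members, the point-by-member incidence matrix has rank below [n]; a
    nonzero vector of its left kernel is a weight vanishing on every member. Leaving out [set0],
    whose weight is always 0, makes the bound strict. *)
Lemma saturated_card n (F : {set {set 'I_n}}) : saturated F -> n < #|F|.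
Proof.
move=> satF; have [F0 _] := saturated_extremes satF.
rewrite (cardsD1 set0 F) F0 add1n ltnS leqNgt; apply/negP => ltn_F.
pose G := F :\ set0.
pose X : 'M[rat]_(n, #|G|) :=
  (\matrix_(i, j) (i \in (enum_val j : {set 'I_n}))%:R)%R.
have : kermx X != 0%R.
  rewrite -mxrank_eq0 mxrank_ker subn_eq0 -ltnNge.
  exact: leq_ltn_trans (rank_leq_col X) ltn_F.
case/rowV0Pn => v /sub_kermxP vX /rV0Pn[i].
rewrite (@saturated_weight_eq0 _ (v 0%R) F) ?eqxx //.
move=> x xF; have [->|x0] := eqVneq x set0; first by rewrite /weight big_set0.
have xG : x \in G by rewrite !inE x0.
have := congr1 (fun m : 'rV_#|G| => m 0%R (enum_rank_in xG x)) vX.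
rewrite !mxE => <-; rewrite /weight big_mkcond; apply: eq_bigr => j _.
by rewrite mxE enum_rankK_in //; case: (j \in x); rewrite ?mulr1 ?mulr0.
Qed.

(* |F| >= (n+6)/4, stated equivalently over nat as 4 * |F| >= n + 6 *)
Theorem theorem4p2 (n : nat) (F : {set {set 'I_n}}) :
  0 < n -> N_saturated F -> n + 6 <= 4 * #|F|.
Proof.
move=> n_gt0 /saturated_card ltnF.
(* It remains to see that [4 * n.+1], which is [n + (4 + 3 * n)], is at least [n + 6]; this is
   [2 <= 3 * n], true for positive [n]. *)
apply: leq_trans (leq_mul (leqnn 4) ltnF).
rewrite mulnS mulSn addnCA leq_add2l -[6]/(4 + 2) leq_add2l.
exact: leq_trans (leq_pmulr 3 n_gt0).
Qed.
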